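(* Let $X$ and $Y$ be Banach spaces that are Lipschitz isomorphic, i.e. there is a bijection $U:Y\to X$ such that $U$ and $U^{-1}$ are Lipschitz. If $Y$ is linearly isomorphic to a (closed linear) subspace of $c_0(\mathbb N)$, then $X$ is linearly isomorphic to a subspace of $c_0(\mathbb N)$.
   Context: Here $c_0(\mathbb N)$ denotes the Banach space of real null sequences with the supremum norm. *)

(* Defs.v *)
From HB Require Import structures.
From mathcomp Require Import all_boot all_order all_algebra.
From mathcomp Require Import all_classical all_reals all_analysis.
Set Implicit Arguments. Unset Strict Implicit. Unset Printing Implicit Defensive.
Import Order.TTheory GRing.Theory Num.Theory.
Import numFieldNormedType.Exports.
Local Open Scope classical_set_scope.
Local Open Scope ring_scope.

Definition c0 (R : realType) : set (nat -> R) :=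
  [set u | u @ \oo --> (0 : R)].

Definition supnorm (R : realType) (u : nat -> R) : R :=
  sup (range (fun n => `|u n|)).

Definition lin_iso_subspace_c0 (R : realType) (Y : normedModType R) : Prop :=
  exists T : Y -> (nat -> R),
    (forall (a : R) (y z : Y) (n : nat), T (a *: y + z) n = a * T y n + T z n) /\
    (forall y, c0 (T y)) /\
    exists c C : R, 0 < c /\ 0 < C /\
      forall y : Y, c * `|y| <= supnorm (T y) /\ supnorm (T y) <= C * `|y|.

Definition lipschitz_map (R : realType) (A B : normedModType R) (f : A -> B) : Prop :=
  exists L : R, forall x y : A, `|f x - f y| <= L * `|x - y|.

Definition lipschitz_isomorphic (R : realType) (X Y : normedModType R) : Prop :=
  exists (U : Y -> X) (V : X -> Y),
    cancel U V /\ cancel V U /\ lipschitz_map U /\ lipschitz_map V.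

(* Main.v *)
Require Import Defs.
From HB Require Import structures.
From mathcomp Require Import all_boot all_order all_algebra.
From mathcomp Require Import all_classical all_reals all_analysis.
From mathcomp Require Import ring lra.
Set Implicit Arguments. Unset Strict Implicit. Unset Printing Implicit Defensive.
Import Order.TTheory GRing.Theory Num.Theory.
Import numFieldNormedType.Exports.
Local Open Scope ring_scope.

(** Identify [Y] with a subspace of [c0] and let [N f] be the Lipschitz constant of
    [f \o U], for [f] in the unit ball of the dual of [X]. If [a, b] almost realise the
    Lipschitz constant of [g \o U], then, as in [c0], all small vectors [v] with
    negligible first coordinates give almost metric midpoints [m + v] of [a, b].
    By Gorelik's principle the points [U (m + v)] cover, up to finitely many translates,
    a ball of [X] of comparable radius. Hence [N] is Lipschitz weak* Kadec-Klee:
    [|f - g| <= D (N f - N g + e)] for [f] weak*-close to [g]. Gorelik's principle is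
    a form of Brouwer's theorem, obtained here from a mod 2 cubical cup product.

    By weak* compactness, for each [n] finitely many nodes [g] suffice for every [f] of
    the dual ball to be close to a node in the above sense with [e = e_n], and
    [e_n]-close on [z_0, .., z_(n-1)], where [z] is dense. Attaching to each node of
    level [n + 1] such a node of level [n] gives a tree along which the gains of [N]
    telescope. The normalised differences along the edges are therefore a norming
    sequence, and it is weak*-null: it embeds [X] into [c0]. *)

(** * A discrete Poincare-Miranda theorem *)

Section DiscreteBrouwer.
Variables (n m : nat).
Local Notation point := {ffun 'I_n -> nat}.
Local Notation K := 'F_2.
Implicit Types (p c : point) (i j : 'I_n) (S : {set 'I_n}).

Variable lam : 'I_n -> point -> K.

Definition step p j : point := [ffun i => p i + (i == j)]%N.
Definition place p j (a : nat) : point := [ffun i => if i == j then a else p i].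

(* The cubical cup product [d l_1 \cup .. \cup d l_k] at the cube with lowest
   corner [p] and directions [S]: a sum over monotone edge paths. *)
Fixpoint cup (s : seq 'I_n) S p : K :=
  if s is k :: s' then
    \sum_(j in S) (lam k (step p j) - lam k p) * cup s' (S :\ j) (step p j)
  else 1.

Fixpoint gridsum (s : seq 'I_n) (F : point -> K) c : K :=
  if s is j :: s' then \sum_(a < m) gridsum s' F (place c j a) else F c.

Lemma F2_addrr (x : K) : x + x = 0.
Proof. by apply/val_inj; case: x => -[|[|?]]. Qed.

Lemma F2_oppr (x : K) : - x = x.
Proof. by apply/eqP; rewrite eq_sym -subr_eq0 opprK F2_addrr. Qed.

(** Each unordered pair is counted twice, which is zero modulo 2. *)
Lemma sum_sym_F2 S (F : 'I_n -> 'I_n -> K) :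
  (forall i j, F i j = F j i) -> \sum_(i in S) \sum_(j in S :\ i) F i j = 0.
Proof.
move=> Fsym.
have -> : \sum_(i in S) \sum_(j in S :\ i) F i j =
  \sum_(i in S) \sum_(j in S | (j < i)%N) F i j +
  \sum_(i in S) \sum_(j in S | (i < j)%N) F i j.
  rewrite -big_split; apply: eq_bigr => i iS /=.
  rewrite (bigID (fun j => (j < i)%N)) /=; congr (_ + _); apply: eq_bigl => j.
    by rewrite !inE; case: ltngtP => [ji|//|//]; rewrite ?andbF //= !andbT -val_eqE ltn_eqF.
  rewrite !inE -leqNgt ltn_neqAle -val_eqE eq_sym.
  by case: (_ == _); case: (_ <= _)%N; rewrite /= ?andbF ?andbT.
rewrite [X in _ + X](exchange_big_dep (fun j => j \in S)) /=; last by move=> i j _ /andP[].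
apply: etrans (F2_addrr (\sum_(i in S) \sum_(j in S | (j < i)%N) F i j)).
congr (_ + _); apply: eq_bigr => j jS; apply: eq_big => [i|i _]; last exact: Fsym.
by rewrite jS.
Qed.

Lemma step_comm p i j : step (step p i) j = step (step p j) i.
Proof. by apply/ffunP => k; rewrite !ffunE addnAC. Qed.

Lemma setD1AC S i j : S :\ i :\ j = S :\ j :\ i.
Proof. by apply/setP => k; rewrite !inE andbCA. Qed.

Lemma sum_setD1_exchange S (F : 'I_n -> 'I_n -> K) :
  \sum_(i in S) \sum_(j in S :\ i) F i j = \sum_(j in S) \sum_(i in S :\ j) F i j.
Proof.
rewrite (exchange_big_dep (fun j => j \in S)) /=; last by move=> i j _ /setD1P[].
apply: eq_bigr => j jS; apply: eq_bigl => i; rewrite !inE jS andbT eq_sym.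
by rewrite andbC.
Qed.

(* A cup product of exact cochains is closed. *)
Lemma cup_closed s S p :
  \sum_(j in S) cup s (S :\ j) (step p j) = \sum_(j in S) cup s (S :\ j) p.
Proof.
elim: s S p => [//|k s IH] S p /=; set l := lam k.
have E1 i : \sum_(j in S :\ i) cup s (S :\ i :\ j) (step (step p i) j) =
    \sum_(j in S :\ i) cup s (S :\ i :\ j) (step p i) by exact: IH.
transitivity (\sum_(i in S) l (step p i) *
   (\sum_(j in S :\ i) cup s (S :\ i :\ j) (step (step p i) j))).
  under eq_bigr => j _ do (under eq_bigr => i _ do rewrite mulrBl; rewrite big_split /=).
  rewrite big_split /= sum_sym_F2 ?add0r; last first.
    by move=> i j; rewrite step_comm setD1AC.
  apply: eq_bigr => i _; rewrite mulr_sumr; apply: eq_bigr => j _.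
  by rewrite F2_oppr.
symmetry.
under eq_bigr => j _ do (under eq_bigr => i _ do rewrite mulrBl; rewrite big_split /=).
rewrite big_split /= [X in _ + X](_ : _ = 0) ?addr0.
  rewrite sum_setD1_exchange; apply: eq_bigr => i _; rewrite E1 mulr_sumr.
  by apply: eq_bigr => j _; rewrite setD1AC.
rewrite sum_setD1_exchange.
transitivity (- l p * \sum_(i in S) \sum_(j in S :\ i) cup s (S :\ i :\ j) (step p i)).
  rewrite mulr_sumr; apply: eq_bigr => i _; rewrite mulr_sumr.
  by apply: eq_bigr => j _; rewrite setD1AC mulNr.
under eq_bigr => i _ do rewrite -E1.
rewrite sum_sym_F2 ?mulr0// => i j.
by rewrite step_comm setD1AC.
Qed.

(** Leibniz rule: the tail being closed, its product with [d l_k] is the coboundary of [l_k] times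
    the tail. The terms become differences between opposite faces, ready to telescope. *)
Lemma cup_cons k s S p : cup (k :: s) S p =
  \sum_(j in S) (lam k (step p j) * cup s (S :\ j) (step p j) - lam k p * cup s (S :\ j) p).
Proof.
rewrite /=; under eq_bigr => j _ do rewrite mulrBl.
by rewrite !big_split/= !sumrN -!mulr_sumr cup_closed.
Qed.

(** A path with directions in [S] never moves along [j]; it stays in a hyperplane where label [k] is
    constant, so the factor [d l_k] vanishes. *)
Lemma cup_const (s : seq 'I_n) k S p j a : k \in s -> j \notin S ->
  (forall q : point, q j = p j -> lam k q = a) -> cup s S p = 0.
Proof.
elim: s S p => [//|l' s IH] S p; rewrite inE => lls jS la /=.
apply: big1 => i iS; have neq : (j == i) = false.
  by apply: contraNF jS => /eqP->.
have sj : step p i j = p j by rewrite ffunE neq addn0.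
case/predU1P: lls => [<-|lls].
  by rewrite !la// subrr mul0r.
rewrite IH ?mulr0//; first by rewrite !inE negb_and jS orbT.
by move=> q; rewrite sj; apply: la.
Qed.

Lemma place_place c i j a b : i != j ->
  place (place c i a) j b = place (place c j b) i a.
Proof.
move=> ij; apply/ffunP => k; rewrite !ffunE.
by case: eqVneq => [->|//]; case: eqVneq => // e; rewrite e eqxx in ij.
Qed.

Lemma gridsum_place s F c j a : j \notin s ->
  gridsum s F (place c j a) = gridsum s (fun p => F (place p j a)) c.
Proof.
elim: s c => [//|i s IH] c /=; rewrite inE negb_or => /andP[ji js].
by apply: eq_bigr => b _; rewrite place_place// IH.
Qed.

Lemma eq_gridsum s F G c : F =1 G -> gridsum s F c = gridsum s G c.
Proof. by move=> FG; elim: s c => [//|i s IH] c /=; apply: eq_bigr => b _. Qed.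

Lemma gridsum_sum s T (r : seq T) (Q : pred T) (F : T -> point -> K) c :
  gridsum s (fun p => \sum_(t <- r | Q t) F t p) c = \sum_(t <- r | Q t) gridsum s (F t) c.
Proof.
elim: s c => [//|i s IH] c /=; rewrite exchange_big/=.
by apply: eq_bigr => b _; rewrite IH.
Qed.

Lemma gridsum0 s c : gridsum s (fun=> 0) c = 0.
Proof. by elim: s c => [//|i s IH] c /=; exact: big1. Qed.

Lemma gridsumB s F G c : gridsum s (fun p => F p - G p) c = gridsum s F c - gridsum s G c.
Proof.
elim: s c => [//|i s IH] c /=; rewrite -sumrB.
by apply: eq_bigr => b _; rewrite IH.
Qed.

Lemma gridsum_diff_head s G c j : j \notin s ->
  gridsum (j :: s) (fun p => G (step p j) - G p) c =
  gridsum s G (place c j m) - gridsum s G (place c j 0).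
Proof.
move=> js /=.
have E (a : nat) : gridsum s (fun p => G (step p j) - G p) (place c j a) =
   gridsum s G (place c j a.+1) - gridsum s G (place c j a).
  rewrite gridsumB; congr (_ - _); rewrite !gridsum_place//; apply: eq_gridsum => p.
  by congr G; apply/ffunP => k; rewrite !ffunE; case: eqVneq; rewrite ?addn1 ?addn0.
under eq_bigr => a _ do rewrite E.
by rewrite -(big_mkord xpredT (fun a => _ (place c j a.+1) - _ (place c j a))) telescope_sumr.
Qed.

Lemma gridsum_diff0 s G c j : uniq s -> j \in s -> 
  (forall p, G (place p j m) = 0) -> (forall p, G (place p j 0) = 0) ->
  gridsum s (fun p => G (step p j) - G p) c = 0.
Proof.
move=> + + Gm G0; elim: s c => [//|i s IH] c /= /andP[is_ us]; rewrite inE.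
case/predU1P => [ji|js]; last by apply: big1 => a _; apply: IH.
subst i; apply: etrans (@gridsum_diff_head s G c j is_) _; rewrite !gridsum_place//.
rewrite (eq_gridsum _ _ Gm) (eq_gridsum _ _ G0) subrr //.
Qed.

(** Discrete Stokes and induction on the dimension: the sum reduces to boundary faces, and only the
    far face in direction [j0] contributes, with the same sum in one dimension less. *)
Lemma gridsum_cup_label s  c :
  uniq s ->
  (forall j (p : point), p j = 0%N -> lam j p = 0) ->
  (forall j (p : point), p j = m -> lam j p = 1) ->
  gridsum s (cup s [set j in s]) c = 1.
Proof.
move=> + lam0 lam1; elim: s c => [//|j0 s IH] c us.
rewrite (eq_gridsum _ _ (cup_cons _ _ _)) gridsum_sum.
have /andP[j0s us'] := us.
have D0 : [set j in j0 :: s] :\ j0 = [set j in s].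
  by apply/setP => k; rewrite !inE; case: eqVneq => [->|//]; rewrite (negbTE j0s).
rewrite (bigD1 j0) ?inE ?eqxx//= [X in _ + X]big1 ?addr0 => [|j].
  rewrite -/(gridsum (j0 :: s) _ c).
  rewrite (@gridsum_diff_head s (fun p => lam j0 p * cup s ([set j in j0 :: s] :\ j0) p)) //.
  rewrite D0 [X in _ - X](_ : _ = 0) ?subr0.
    rewrite -[RHS](IH (place c j0 m) us') !gridsum_place//; apply: eq_gridsum => p.
    by rewrite lam1 ?mul1r// ffunE eqxx.
  rewrite gridsum_place// -[RHS](gridsum0 s c); apply: eq_gridsum => p.
  by rewrite lam0 ?mul0r// ffunE eqxx.
(* On the two faces orthogonal to another direction [j], label [j] is constant and [j] occurs in
   [s], so the cup product vanishes there. *)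
rewrite !inE => /andP[+ jj0]; rewrite (negbTE jj0)/= => js.
have js' : j \in j0 :: s by rewrite inE js orbT.
rewrite -/(gridsum (j0 :: s) _ c).
apply: (@gridsum_diff0 (j0 :: s) (fun p => lam j0 p * cup s ([set j in j0 :: s] :\ j) p)) => // p.
  rewrite (@cup_const _ j _ _ j 1) ?mulr0//; first by rewrite !inE eqxx.
  by move=> q; rewrite ffunE eqxx; apply: lam1.
rewrite (@cup_const _ j _ _ j 0) ?mulr0//; first by rewrite !inE eqxx.
by move=> q; rewrite ffunE eqxx; apply: lam0.
Qed.

Lemma gridsum_neq0 (s : seq 'I_n) F c : gridsum s F c != 0 -> exists p : point,
  [/\ F p != 0, (forall j, j \notin s -> p j = c j) &
    (forall j, j \in s -> (p j < m)%N)].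
Proof.
elim: s c => [|i s IH] c /= F0; first by exists c.
have [a Fa] : exists a : 'I_m, gridsum s F (place c i a) != 0.
  apply/existsP; apply: contraNT F0; rewrite negb_exists => /forallP F0.
  by rewrite big1// => a _; apply/eqP; move: (F0 a); rewrite negbK.
have [p [Fp pc pm]] := IH _ Fa; exists p; split => // j; rewrite inE.
  by rewrite negb_or => /andP[/negbTE ji js]; rewrite pc// ffunE ji.
case: (boolP (j \in s)) => [js _|js]; first exact: pm.
by rewrite orbF => /eqP ji; subst j; rewrite pc// ffunE eqxx.
Qed.

(** A nonzero summand is an edge path along which no factor vanishes, so each label in [s] changes
    on some edge of the cube. *)
Lemma cup_neq0 (s : seq 'I_n) S p k : cup s S p != 0 -> k \in s -> exists q q' : point,
  [/\ lam k q != lam k q', (forall i, p i <= q i <= p i + (i \in S))%N &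
    (forall i, p i <= q' i <= p i + (i \in S))%N].
Proof.
elim: s S p => [//|l' s IH] S p /= c0; rewrite inE => lls.
have [j] : exists j, (j \in S) && ((lam l' (step p j) - lam l' p) * cup s (S :\ j) (step p j) != 0).
  apply/existsP; apply: contraNT c0; rewrite negb_exists => /forallP F0.
  by rewrite big1// => a aS; apply/eqP; move: (F0 a); rewrite aS negbK.
rewrite mulf_eq0 negb_or subr_eq0 => /and3P[jS l'0 cup0].
case/predU1P: lls => [->|lls].
  exists (step p j), p; split => // i; rewrite ?ffunE ?leqnn ?leq_addr//.
  by rewrite leq_add2l/=; case: eqVneq => [->|_]; rewrite ?jS.
have [q [q' [lqq' pq pq']]] := IH _ _ cup0 lls; exists q, q'; split => // i.
  have := pq i; rewrite !ffunE !inE -addnA => /andP[h1 h2].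
  rewrite (leq_trans (leq_addr _ _) h1)/= (leq_trans h2)// leq_add2l.
  by case: eqVneq => [->|_]; rewrite ?jS.
have := pq' i; rewrite !ffunE !inE -addnA => /andP[h1 h2].
rewrite (leq_trans (leq_addr _ _) h1)/= (leq_trans h2)// leq_add2l.
by case: eqVneq => [->|_]; rewrite ?jS.
Qed.

End DiscreteBrouwer.

(** The cup products over the grid sum to 1 modulo 2, so one of them is nonzero, and on that cube
    every label takes both values. *)
Theorem discrete_poincare_miranda n m (lam : 'I_n -> {ffun 'I_n -> nat} -> bool) :
  (forall j (p : {ffun 'I_n -> nat}), p j = 0%N -> ~~ lam j p) ->
  (forall j (p : {ffun 'I_n -> nat}), p j = m -> lam j p) ->
  exists p : {ffun 'I_n -> nat}, (forall j, p j < m)%N /\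
    forall j, exists q q' : {ffun 'I_n -> nat},
    [/\ ~~ lam j q, lam j q', (forall i, p i <= q i <= (p i).+1)%N &
       (forall i, p i <= q' i <= (p i).+1)%N].
Proof.
move=> lam0 lam1; pose l j p : 'F_2 := (lam j p)%:R.
have l0 j (p : {ffun 'I_n -> nat}) : p j = 0%N -> l j p = 0.
  by move=> /lam0/negbTE; rewrite /l => ->.
have l1 j (p : {ffun 'I_n -> nat}) : p j = m -> l j p = 1 by move=> /lam1; rewrite /l => ->.
have sum1 := gridsum_cup_label [ffun=> 0%N] (enum_uniq 'I_n) l0 l1.
have := oner_neq0 'F_2; rewrite -sum1 => /gridsum_neq0[p [cupp _ pm]].
exists p; split => [j|j]; first by apply: pm; rewrite mem_enum.
have [|q [q' [lqq' pq pq']]] := cup_neq0 (k := j) cupp; first by rewrite mem_enum.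
have h (r : {ffun 'I_n -> nat}) : (forall i, p i <= r i <= p i + (i \in [set j in enum 'I_n]))%N ->
    forall i, (p i <= r i <= (p i).+1)%N.
  by move=> pr i; have := pr i; rewrite inE mem_enum addn1.
move: lqq'; rewrite /l; case lq: (lam j q); case lq': (lam j q'); rewrite ?eqxx// => _.
  by exists q', q; rewrite lq lq'; split => //; exact: h.
by exists q, q'; rewrite lq lq'; split => //; exact: h.
Qed.

(** * The Gorelik principle *)

Definition seminorm (R : realType) (E : lmodType R) (p : E -> R) :=
  (forall a y, p (a *: y) = `|a| * p y) /\ (forall y z, p (y + z) <= p y + p z).

Section Seminorm.
Variables (R : realType) (E : lmodType R) (p : E -> R).
Hypothesis pS : seminorm p.

Lemma seminormZ a y : p (a *: y) = `|a| * p y. Proof. exact: pS.1. Qed.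
Lemma ler_seminormD y z : p (y + z) <= p y + p z. Proof. exact: pS.2. Qed.
Lemma seminorm0 : p 0 = 0.
Proof. by rewrite -(scale0r (0 : E)) seminormZ normr0 mul0r. Qed.
Lemma seminormN y : p (- y) = p y.
Proof. by rewrite -scaleN1r seminormZ normrN1 mul1r. Qed.
Lemma seminormB y z : p (y - z) = p (z - y).
Proof. by rewrite -seminormN opprB. Qed.
Lemma ler_seminormB y z : p (y - z) <= p y + p z.
Proof. by rewrite -(seminormN z) ler_seminormD. Qed.
Lemma ler_seminorm_dist y z : `|p y - p z| <= p (y - z).
Proof.
rewrite ler_norml; have := ler_seminormD (y - z) z; have := ler_seminormD (z - y) y.
by rewrite !subrK (seminormB z y) => ? ?; apply/andP; split; lra.
Qed.
Lemma seminorm_ge0 y : 0 <= p y.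
Proof. by have := ler_seminormB y y; rewrite subrr seminorm0; lra. Qed.
Lemma ler_seminorm_sum n (F : 'I_n -> E) :
  p (\sum_i F i) <= \sum_i p (F i).
Proof.
elim/big_ind2: _ => [|x1 x2 y1 y2 h1 h2|//]; first by rewrite seminorm0.
exact: le_trans (ler_seminormD _ _) (lerD h1 h2).
Qed.
End Seminorm.

(* The finite set is the image of a grid of the simplex spanned by a [Q]-net of
   the [p]-ball; Schauder projection onto the net turns [a - phi a] into barycentric
   coordinates, whose approximate fixed points are approximate zeros of [phi]. *)
Lemma gorelik_seminorm (R : realType) (E : lmodType R) (p Q : E -> R) (r L eta : R) :
  seminorm p -> seminorm Q -> (forall y, Q y <= p y) ->
  (forall k : R, 0 < k -> exists J (P : 'I_J -> E), (forall j, p (P j) <= r) /\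
     forall y, p y <= r -> exists j, Q (y - P j) <= k) ->
  0 < r -> 0 <= L -> 0 < eta ->
  exists A : seq E, forall phi : E -> E,
    (forall a, p (phi a - a) <= r) ->
    (forall a b, p (phi a - phi b) <= L * p (a - b)) ->
    exists a, [/\ a \in A, p a <= r & Q (phi a) <= eta].
Proof.
move=> pS QS Qp net r0 L0 eta0.
pose k := Num.min (eta / 4) (1 / 2).
have k0 : 0 < k by rewrite lt_min; apply/andP; split; lra.
have keta : k <= eta / 4 by rewrite ge_min lexx.
have k12 : k <= 1 / 2 by rewrite ge_min lexx orbT.
have [J [P [Pr Pnet]]] := net _ k0.
(* [C / m] will bound the displacement of [a] across a grid cell of mesh [1 / m]. *)
pose C : R := 2 * J%:R * (1 + J%:R) * r / k.
have J0 : 0 <= J%:R :> R by rewrite ler0n.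
have C0 : 0 <= C by rewrite /C !mulr_ge0 ?invr_ge0//; lra.
(* Tolerance between grid coordinates and Schauder weights; the two bounds keep [J * om] small
   against the total weight and against [eta]. *)
pose om : R := Num.min (k / 2 / (1 + J%:R)) (eta * k / 8 / r / (1 + J%:R)).
have om0 : 0 < om.
  by rewrite lt_min; apply/andP; split; rewrite !(mulr_gt0, invr_gt0)//; lra.
have [m m0 mom] : exists2 m, (0 < m)%N & (1 + (1 + L) * C) / m%:R <= om.
  exists (Num.trunc ((1 + (1 + L) * C) / om)).+1 => //.
  rewrite ler_pdivrMr ?ltr0n// -ler_pdivrMl//.
  by rewrite [leLHS]mulrC ltW// truncnS_gt.
have mR0 : 0 < m%:R :> R by rewrite ltr0n.
pose t (x : {ffun 'I_J -> nat}) j : R := (x j)%:R / m%:R.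
have t0 x j : 0 <= t x j by rewrite divr_ge0// ler0n.
(* The floor [k / 2] makes the division in [a] harmless at every grid point; at the cell found
   below, [D] is the plain sum. *)
pose D x := Num.max (k / 2) (\sum_j t x j).
have Dk x : k / 2 <= D x by rewrite le_max lexx.
have Dt x : \sum_j t x j <= D x by rewrite le_max lexx orbT.
have D0 x : 0 < D x by apply: lt_le_trans (Dk x); lra.
have tD x j : t x j <= D x.
  by apply: le_trans (Dt x); rewrite (bigD1 j)//= lerDl sumr_ge0.
pose a x := \sum_j (t x j / D x) *: P j.
have pa x : p (a x) <= r.
  apply: le_trans (ler_seminorm_sum pS _) _.
  apply: (@le_trans _ _ (\sum_j (t x j / D x) * r)).
    apply: ler_sum => j _; rewrite seminormZ// ger0_norm ?divr_ge0// ?(ltW (D0 _))//.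
    by rewrite ler_wpM2l// divr_ge0// ltW.
  rewrite -mulr_suml -mulr_suml; apply: ler_piMl; first exact: ltW.
  by rewrite ler_pdivrMr// mul1r.
exists [seq a [ffun j => nat_of_ord (f j)] | f : {ffun 'I_J -> 'I_m}] => phi phir phiL.
pose c x := a x - phi (a x).
have pc x : p (c x) <= r by rewrite seminormB.
(* Schauder weights: zero when [P j] is farther than [2 * k], at least [k] when it is within [k]. *)
pose u j y := Num.max 0 (2 * k - Q (y - P j)).
have u1 j y : u j y <= 1.
  by rewrite ge_max; apply/andP; split; have := seminorm_ge0 QS (y - P j); lra.
have uL j y z : `|u j y - u j z| <= Q (y - z).
  have := ler_seminorm_dist QS (y - P j) (z - P j).
  rewrite opprB addrA subrK /u !ler_norml => /andP[h1 h2].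
  have := seminorm_ge0 QS (y - z) => h3.
  by apply/andP; split; case: (leP 0 (2 * k - Q (y - P j))) => ?;
    case: (leP 0 (2 * k - Q (z - P j))) => ?; lra.
(* The clause [0 < x j] forces a false label on the near face; on the far face [t] is 1, above every
   weight. A change of label within a cell means that [t x j] is close to [u j (c x)]. *)
pose lam j (x : {ffun 'I_J -> nat}) := (0 < x j)%N && (u j (c x) <= t x j).
have [|j x xm|x [xm xlam]] := @discrete_poincare_miranda J m lam.
- by move=> j x; rewrite /lam => ->.
- by rewrite /lam xm m0 /t xm divff ?gt_eqF ?u1.
have tcell (z : {ffun 'I_J -> nat}) j : (x j <= z j <= (x j).+1)%N -> `|t z j - t x j| <= m%:R^-1.
  move=> /andP[h1 h2]; rewrite /t -mulrBl normrM (ger0_norm (x := _^-1)) ?invr_ge0 ?(ltW mR0)//.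
  apply: ler_piMl; first by rewrite invr_ge0 ltW.
  rewrite -natrB// normr_nat (_ : 1 = 1%:R)// ler_nat.
  by rewrite leq_subLR addn1.
have acell (z : {ffun 'I_J -> nat}) : (forall j, x j <= z j <= (x j).+1)%N ->
    p (a z - a x) <= C / m%:R.
  move=> zx.
  have DD : `|D x - D z| <= J%:R / m%:R.
    have h : `|\sum_j t x j - \sum_j t z j| <= J%:R / m%:R.
      rewrite -sumrB (le_trans (ler_norm_sum _ _ _))//.
      apply: (@le_trans _ _ (\sum_(j < J) m%:R^-1)).
        by apply: ler_sum => j _; rewrite distrC tcell.
      by rewrite sumr_const card_ord mulr_natl.
    move: h; rewrite !ler_norml => /andP[h1 h2]; rewrite /D.
    have h3 : 0 <= J%:R / m%:R :> R by rewrite divr_ge0// ltW.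
    by apply/andP; split; case: (leP (k / 2) (\sum_j t x j)) => ?;
      case: (leP (k / 2) (\sum_j t z j)) => ?; lra.
  rewrite /a -sumrB.
  apply: le_trans (ler_seminorm_sum pS _) _.
  apply: (@le_trans _ _ (\sum_(j < J) (1 + J%:R) / m%:R * (2 / k) * r)).
    apply: ler_sum => j _; rewrite -scalerBl seminormZ//.
    apply: ler_pM => //; first exact: seminorm_ge0.
    have -> : t z j / D z - t x j / D x =
       ((t z j - t x j) + t x j / D x * (D x - D z)) / D z.
      by field; rewrite !gt_eqF.
    rewrite normrM; apply: ler_pM => //.
      rewrite (le_trans (ler_normD _ _))// [X in _ <= X]mulrDl mul1r lerD ?tcell//.
      rewrite normrM; apply: le_trans DD; rewrite ler_piMl// ger0_norm ?divr_ge0// ?(ltW (D0 _))//.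
      by rewrite ler_pdivrMr ?mul1r.
    rewrite normfV gtr0_norm//.
    have -> : 2 / k = (k / 2)^-1 by rewrite invf_div.
    by rewrite lef_pV2 ?posrE//; lra.
  rewrite sumr_const card_ord -[leLHS]mulr_natl /C.
  rewrite le_eqVlt; apply/orP; left; apply/eqP.
  by field; rewrite !gt_eqF.
have ucell j (z : {ffun 'I_J -> nat}) : (forall j, x j <= z j <= (x j).+1)%N ->
    `|u j (c z) - u j (c x)| <= (1 + L) * C / m%:R.
  move=> zx; apply: le_trans (uL _ _ _) _; apply: le_trans (Qp _) _.
  have -> : c z - c x = (a z - a x) - (phi (a z) - phi (a x)).
    by rewrite /c !opprB addrACA [in RHS]addrACA [- phi _ - _]addrC.
  apply: le_trans (ler_seminormB pS _ _) _.
  rewrite !mulrDl mul1r lerD ?acell//.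
  by rewrite -mulrA (le_trans (phiL _ _))// ler_wpM2l// acell.
have tu j : `|t x j - u j (c x)| <= om.
  have [q [q' [lq lq' xq xq']]] := xlam j.
  apply: le_trans mom; rewrite mulrDl mul1r.
  move: lq lq'; rewrite /lam => lq /andP[_ lq'].
  have {}lq : t q j <= u j (c q).
    move: lq; rewrite negb_and -leqNgt leqn0 -ltNge => /orP[/eqP q0|/ltW//].
    by rewrite /t q0 mul0r /u le_max lexx.
  have := tcell _ _ (xq j); have := tcell _ _ (xq' j).
  have := ucell j _ xq; have := ucell j _ xq'.
  rewrite !ler_norml => /andP[? ?] /andP[? ?] /andP[? ?] /andP[? ?].
  by apply/andP; split; lra.
have Jom : J%:R * om <= k / 2.
  apply: (@le_trans _ _ ((1 + J%:R) * om)); first by rewrite ler_wpM2r ?(ltW om0)//; lra.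
  by rewrite mulrC -ler_pdivlMr ?ge_min ?lexx//; lra.
have Jom' : J%:R * om <= eta * k / 8 / r.
  apply: (@le_trans _ _ ((1 + J%:R) * om)); first by rewrite ler_wpM2r ?(ltW om0)//; lra.
  by rewrite mulrC -ler_pdivlMr ?ge_min ?lexx ?orbT//; lra.
(* Some net point is within [k] of [c x] and has weight at least [k], so the coordinates add up to
   at least [k / 2]. *)
have Dx : D x = \sum_j t x j.
  apply/max_idPr; have [j0 j0k] := Pnet _ (pc x).
  have : k <= \sum_j u j (c x).
    rewrite (bigD1 j0)//= ler_wpDr//; last by rewrite /u le_max; apply/orP; right; lra.
    by apply: sumr_ge0 => j _; rewrite /u le_max lexx.
  have : \sum_j u j (c x) <= \sum_j t x j + J%:R * om.
    rewrite mulr_natl -[J in om *+ J]card_ord -sumr_const -big_split/=.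
    by apply: ler_sum => j _; have := tu j; rewrite ler_norml => /andP[? ?]; lra.
  lra.
exists (a x); split => //.
  apply/mapP; exists [ffun j => Ordinal (xm j)]; first by rewrite mem_enum.
  by congr a; apply/ffunP => j; rewrite !ffunE.
have -> : phi (a x) = a x - c x by rewrite /c opprB addrCA subrr addr0.
(* An average of the [P j - c x]: those with [Q] above [2 * k] have zero Schauder weight, hence a
   coordinate of at most [om]. *)
have -> : a x - c x = \sum_j (t x j / D x) *: (P j - c x).
  under eq_bigr do rewrite scalerBr.
  rewrite sumrB; congr (_ - _).
  by rewrite -scaler_suml -mulr_suml -Dx divff ?gt_eqF// scale1r.
apply: le_trans (ler_seminorm_sum QS _) _.
apply: (@le_trans _ _ (\sum_j (t x j * (2 * k) + om * (2 * r)) / D x)).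
  apply: ler_sum => j _; rewrite seminormZ// ger0_norm ?divr_ge0// ?(ltW (D0 _))//.
  rewrite mulrAC ler_wpM2r ?invr_ge0 ?(ltW (D0 _))//.
  have Q2r : Q (P j - c x) <= 2 * r.
    apply: le_trans (Qp _) (le_trans (ler_seminormB pS _ _) _).
    by have := Pr j; have := pc x; lra.
  have [Qk|Qk] := leP (Q (P j - c x)) (2 * k).
    by rewrite ler_wpDr ?ler_wpM2l// mulr_ge0//; lra.
  have : u j (c x) = 0 by apply/max_idPl; rewrite (seminormB QS); lra.
  move=> uj; have := tu j; rewrite uj subr0 ger0_norm// => tj.
  apply: ler_wpDl; first by rewrite mulr_ge0//; lra.
  by apply: ler_pM => //; exact: seminorm_ge0.
rewrite -mulr_suml ler_pdivrMr// big_split/= -mulr_suml -Dx sumr_const card_ord -[_ *+ J]mulr_natl.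
apply: (@le_trans _ _ (D x * (eta / 2) + k / 2 * (eta / 2))).
  apply: lerD; first by rewrite ler_wpM2l ?(ltW (D0 _))//; lra.
  rewrite mulrA (le_trans (ler_wpM2r _ Jom'))//; first lra.
  rewrite le_eqVlt; apply/orP; left; apply/eqP.
  by field; rewrite !gt_eqF.
have : k / 2 * (eta / 2) <= D x * (eta / 2) by rewrite ler_wpM2r//; lra.
lra.
Qed.

Lemma truncn_eq_dist (R : realType) (x y : R) : 0 <= x -> 0 <= y ->
  Num.trunc x = Num.trunc y -> `|x - y| <= 1.
Proof.
move=> x0 y0 xy; have := truncn_itv x0; have := truncn_itv y0; rewrite xy -natr1.
by move=> /andP[? ?] /andP[? ?]; rewrite ler_norml; apply/andP; split; lra.
Qed.

(** * Gorelik's principle for finitely many coordinates *)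

Section CoordinateSeminorm.
Variables (R : realType) (E : lmodType R) (p : E -> R) (q : nat -> E -> R) (n : nat).
Hypothesis pS : seminorm p.
Hypothesis qlin : forall k a y z, q k (a *: y + z) = a * q k y + q k z.
Hypothesis qp : forall k y, `|q k y| <= p y.

Definition coord_seminorm (y : E) : R := \big[Num.max/0]_(k < n) `|q k y|.

Lemma coord_le_seminorm k y : (k < n)%N -> `|q k y| <= coord_seminorm y.
Proof.
move=> kn; rewrite /coord_seminorm (bigD1 (Ordinal kn))//=.
by rewrite le_max lexx.
Qed.

Lemma coord_seminorm_le y M : 0 <= M -> (forall k, (k < n)%N -> `|q k y| <= M) ->
  coord_seminorm y <= M.
Proof.
by move=> M0 qM; apply: (big_ind (fun x => x <= M)) => // [a b aM bM|k _];
  [rewrite ge_max aM|exact: qM].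
Qed.

Lemma coord_seminorm_ge0 y : 0 <= coord_seminorm y.
Proof. by apply: (big_ind (fun x => 0 <= x)) => // a b a0 b0; rewrite le_max a0. Qed.

Lemma coord0 k : q k 0 = 0.
Proof. by have := qlin k 1 0 0; rewrite scaler0 addr0 mul1r; lra. Qed.

Lemma coordD k y z : q k (y + z) = q k y + q k z.
Proof. by rewrite -{1}[y]scale1r qlin mul1r. Qed.

Lemma coordZ k a y : q k (a *: y) = a * q k y.
Proof. by rewrite -[a *: y]addr0 qlin coord0 addr0. Qed.

Lemma coordB k y z : q k (y - z) = q k y - q k z.
Proof. by rewrite coordD -scaleN1r coordZ mulN1r. Qed.

Lemma seminorm_coord : seminorm coord_seminorm.
Proof.
have le a y : coord_seminorm (a *: y) <= `|a| * coord_seminorm y.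
  apply: coord_seminorm_le; first by rewrite mulr_ge0// coord_seminorm_ge0.
  by move=> k kn; rewrite coordZ normrM ler_wpM2l// coord_le_seminorm.
split=> [a y|y z].
  apply/eqP; rewrite eq_le le/=; have [->|a0] := eqVneq a 0.
    by rewrite normr0 mul0r coord_seminorm_ge0.
  rewrite -ler_pdivlMl ?normr_gt0//; have := le a^-1 (a *: y).
  by rewrite scalerA mulVf// scale1r normfV.
apply: coord_seminorm_le; first by rewrite addr_ge0// coord_seminorm_ge0.
by move=> k kn; rewrite coordD (le_trans (ler_normD _ _))// lerD// coord_le_seminorm.
Qed.

(** Rounding the first [n] coordinates to mesh [e] leaves finitely many codes on the [p]-ball. The
    net has one vector of the ball per occurring code, and [0] for the other codes. *)
Lemma coord_net (r e : R) : 0 < r -> 0 < e ->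
  exists J (P : 'I_J -> E), (forall j, p (P j) <= r) /\
    forall y, p y <= r -> exists j, coord_seminorm (y - P j) <= e.
Proof.
move=> r0 e0; pose B := (Num.trunc (2 * r / e)).+1.
pose code y k := Num.trunc ((q k y + r) / e).
have pos y k : p y <= r -> 0 <= (q k y + r) / e.
  move=> yr; rewrite divr_ge0 ?(ltW e0)//.
  by have := le_trans (qp k y) yr; rewrite ler_norml => /andP[? _]; lra.
have codeB y k : p y <= r -> (code y k < B)%N.
  move=> yr; rewrite ltnS le_truncn// ler_wpM2r ?invr_ge0 ?(ltW e0)//.
  by have := le_trans (qp k y) yr; rewrite ler_norml => /andP[_ ?]; lra.
have /choice[g gP] : forall f : {ffun 'I_n -> 'I_B}, exists y, p y <= r /\
    forall z, p z <= r -> (forall k : 'I_n, code z k = f k) -> forall k : 'I_n, code y k = f k.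
  move=> f.
  have [[z [zr zf]]|nz] := pselect (exists z, p z <= r /\ forall k : 'I_n, code z k = f k).
    by exists z.
  by exists 0; split=> [|z zr zf]; [rewrite seminorm0// ltW|case: nz; exists z].
exists #|{ffun 'I_n -> 'I_B}|, (g \o enum_val); split=> [j|y yr]; first exact: (gP _).1.
pose f : {ffun 'I_n -> 'I_B} := [ffun k : 'I_n => Ordinal (codeB y k yr)].
exists (enum_rank f); rewrite /= enum_rankK; have [gr gf] := gP f.
apply: coord_seminorm_le => [|k kn]; first exact: ltW.
have /truncn_eq_dist : code y k = code (g f) k.
  by rewrite (gf y yr _ (Ordinal kn)) => [|i]; rewrite ffunE.
move=> /(_ (pos _ _ yr) (pos _ _ gr)).
rewrite -mulrBl opprD addrACA subrr addr0 normrM (gtr0_norm (x := e^-1)) ?invr_gt0//.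
by rewrite ler_pdivrMr// mul1r coordB.
Qed.

(** The finite set [A] serves all maps [phi] at once; it will supply the test points of a weak*
    neighbourhood. *)
Lemma gorelik (r L eta : R) : 0 < r -> 0 <= L -> 0 < eta ->
  exists A : seq E, forall phi : E -> E,
    (forall a, p (phi a - a) <= r) ->
    (forall a b, p (phi a - phi b) <= L * p (a - b)) ->
    exists a, [/\ a \in A, p a <= r & forall k, (k < n)%N -> `|q k (phi a)| <= eta].
Proof.
move=> r0 L0 eta0.
have [||A AP] := @gorelik_seminorm R E p coord_seminorm r L eta pS seminorm_coord _ _ r0 L0 eta0.
- by move=> y; apply: coord_seminorm_le => //; exact: seminorm_ge0.
- by move=> k k0; exact: coord_net.
exists A => phi h1 h2; have [a [aA ar aQ]] := AP phi h1 h2; exists a; split => // k kn.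
exact: le_trans (coord_le_seminorm _ kn) aQ.
Qed.

End CoordinateSeminorm.

(** * The Lipschitz weak* Kadec-Klee property *)

Local Open Scope classical_set_scope.
Local Open Scope ring_scope.

(** Bare functions, so that the ball lies in a product space whose topology induces the weak*
    one. *)
Definition dual_ball (R : realType) (X : normedModType R) : set (X -> R) :=
  [set f | (forall a x y, f (a *: x + y) = a * f x + f y) /\ forall x, `|f x| <= `|x|].

Section DualBall.
Variables (R : realType) (X : normedModType R) (f : X -> R).
Hypothesis fK : dual_ball f.

Lemma dual_ball_le x : `|f x| <= `|x|. Proof. exact: fK.2. Qed.

Lemma dual_ball0 : f 0 = 0.
Proof. by apply/eqP; rewrite -normr_le0 (le_trans (dual_ball_le 0))// normr0. Qed.

Lemma dual_ballD x y : f (x + y) = f x + f y.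
Proof. by rewrite -{1}[x]scale1r fK.1 mul1r. Qed.

Lemma dual_ballZ a x : f (a *: x) = a * f x.
Proof. by rewrite -[a *: x]addr0 fK.1 dual_ball0 addr0. Qed.

Lemma dual_ballB x y : f (x - y) = f x - f y.
Proof. by rewrite dual_ballD -scaleN1r dual_ballZ mulN1r. Qed.
End DualBall.

Section LipschitzKadecKlee.
Variables (R : realType) (X Y : normedModType R) (U : Y -> X) (V : X -> Y).
Variables (p : Y -> R) (q : nat -> Y -> R) (c C LU LV : R).
Hypotheses (UK : cancel U V) (VK : cancel V U).
Hypotheses (c0 : 0 < c) (C0 : 0 < C) (LU0 : 0 < LU) (LV0 : 0 < LV).
Hypothesis Ulip : forall x y, `|U x - U y| <= LU * `|x - y|.
Hypothesis Vlip : forall x y, `|V x - V y| <= LV * `|x - y|.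
Hypothesis pS : seminorm p.
Hypothesis qlin : forall k a y z, q k (a *: y + z) = a * q k y + q k z.
Hypothesis qp : forall k y, `|q k y| <= p y.
Hypothesis pq : forall y M, (forall k, `|q k y| <= M) -> p y <= M.
Hypothesis qnull : forall y (e : R), 0 < e -> exists n, forall k, (n <= k)%N -> `|q k y| <= e.
Hypothesis cp : forall y, c * `|y| <= p y.
Hypothesis pC : forall y, p y <= C * `|y|.

(** Lipschitz quotients of [f \o U] for the distance given by [p]; a pair with [y = z] contributes
    the default value 0. *)
Definition lip_quotients (f : X -> R) : set R :=
  range (fun yz : Y * Y => `|f (U yz.1) - f (U yz.2)| / p (yz.1 - yz.2)).

Definition lip_norm (f : X -> R) : R := sup (lip_quotients f).

Lemma equiv_seminorm_eq0 y : (p y == 0) = (y == 0).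
Proof.
apply/eqP/eqP => [py|->]; last exact: seminorm0.
by apply/eqP; rewrite -normr_le0 -(pmulr_rle0 _ c0) -py.
Qed.

Lemma equiv_seminorm_gt0 y : (0 < p y) = (y != 0).
Proof. by rewrite lt0r equiv_seminorm_eq0 seminorm_ge0// andbT. Qed.

Lemma lip_quotient_le f y z : dual_ball f -> `|f (U y) - f (U z)| <= LU / c * p (y - z).
Proof.
move=> fK; rewrite -dual_ballB// (le_trans (dual_ball_le fK _))//.
rewrite (le_trans (Ulip _ _))// -mulrA ler_wpM2l ?(ltW LU0)//.
by rewrite ler_pdivlMl.
Qed.

Lemma lip_quotients_ubound f : dual_ball f -> ubound (lip_quotients f) (LU / c).
Proof.
move=> fK _ [[y z] _ <-] /=; have [->|yz] := eqVneq y z.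
  by rewrite !subrr normr0 mul0r divr_ge0// ltW.
by rewrite ler_pdivrMr ?lip_quotient_le// equiv_seminorm_gt0 subr_eq0.
Qed.

Lemma lip_quotients_has_sup f : dual_ball f -> has_sup (lip_quotients f).
Proof.
move=> fK; split; last by exists (LU / c); exact: lip_quotients_ubound.
by exists (`|f (U 0) - f (U 0)| / p (0 - 0)), (0, 0).
Qed.

Lemma lip_norm_le f : dual_ball f -> lip_norm f <= LU / c.
Proof.
move=> fK; apply: ge_sup; last exact: lip_quotients_ubound.
by have [] := lip_quotients_has_sup fK.
Qed.

Lemma lip_norm_ge0 f : dual_ball f -> 0 <= lip_norm f.
Proof.
move=> fK; apply: (@ub_le_sup _ (lip_quotients f)).
  by have [] := lip_quotients_has_sup fK.
by exists (0, 0) => //=; rewrite !subrr normr0 mul0r.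
Qed.

Lemma lip_normP f y z : dual_ball f -> `|f (U y) - f (U z)| <= lip_norm f * p (y - z).
Proof.
move=> fK; have [->|yz] := eqVneq y z.
  by rewrite !subrr normr0 mulr_ge0 ?lip_norm_ge0// seminorm_ge0.
rewrite -ler_pdivrMr ?equiv_seminorm_gt0 ?subr_eq0//; apply: (@ub_le_sup _ (lip_quotients f)).
  by have [] := lip_quotients_has_sup fK.
by exists (y, z).
Qed.

Lemma lip_norm_adherent f e : dual_ball f -> 0 < e -> (exists y : Y, y != 0) ->
  exists a b, a != b /\ (lip_norm f - e) * p (a - b) <= f (U a) - f (U b).
Proof.
move=> fK e0 [y0 y00].
suff [a [b [ab h]]] : exists a b, a != b /\
    (lip_norm f - e) * p (a - b) <= `|f (U a) - f (U b)|.
  have [fab|fab] := leP 0 (f (U a) - f (U b)).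
    by exists a, b; split => //; rewrite (ger0_norm fab) in h.
  exists b, a; rewrite eq_sym ab; split => //.
  by rewrite (seminormB pS) -[leRHS]opprB -(ltr0_norm fab).
(* If [lip_norm f <= e], any two distinct points do; otherwise the near-optimal quotient is
   positive, so its points are distinct. *)
have [Ne|Ne] := leP (lip_norm f - e) 0.
  exists y0, 0; split => //; apply: le_trans (normr_ge0 _).
  by rewrite mulr_le0_ge0// seminorm_ge0.
have [_ [[a b] _ <-] /= h] := sup_adherent e0 (lip_quotients_has_sup fK).
have ab : a != b.
  by apply: contraTneq h => ->; rewrite !subrr normr0 mul0r -leNgt ltW.
by exists a, b; split => //; rewrite -ler_pdivlMr ?equiv_seminorm_gt0 ?subr_eq0// ltW.
Qed.

(** The feature of [c0] behind almost midpoints: for almost disjoint supports, the norm of a sum is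
    almost the maximum of the norms. *)
Lemma p_coord_split h v n eta rho : p h <= rho -> p v <= rho -> 0 <= eta ->
  (forall k, (n <= k)%N -> `|q k h| <= eta) -> (forall k, (k < n)%N -> `|q k v| <= eta) ->
  p (h + v) <= rho + eta.
Proof.
move=> hr vr eta0 hn vn; apply: pq => k; rewrite (coordD qlin) (le_trans (ler_normD _ _))//.
have [nk|kn] := leqP n k.
  by rewrite addrC lerD ?hn// (le_trans (qp _ _)).
by rewrite lerD ?vn// (le_trans (qp _ _)).
Qed.

(* An almost midpoint [x] leaves the values [f (U x)] and [g (U x)] no room beyond the
   gain in Lipschitz constant. *)
Lemma midpoint_dual_le f g a b x eta e th rho : dual_ball f -> dual_ball g ->
  0 <= eta -> p (a - x) <= rho + eta -> p (x - b) <= rho + eta -> p (a - b) = 2 * rho ->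
  (lip_norm g - e) * p (a - b) <= g (U a) - g (U b) ->
  `|f (U a) - g (U a)| <= th -> `|f (U b) - g (U b)| <= th ->
  `|f (U x) - g (U x)| <= rho * (lip_norm f - lip_norm g) + 2 * rho * e + 2 * (LU / c) * eta + th.
Proof.
move=> fK gK eta0 ax xb ab gab fga fgb; rewrite ab in gab.
have Nf := lip_norm_le fK; have Ng := lip_norm_le gK.
have key h : dual_ball h -> h (U a) - h (U x) <= lip_norm h * rho + LU / c * eta /\
    h (U x) - h (U b) <= lip_norm h * rho + LU / c * eta.
  move=> hK; have N0 := lip_norm_ge0 hK.
  have E : lip_norm h * (rho + eta) <= lip_norm h * rho + LU / c * eta.
    by rewrite mulrDr lerD2l ler_wpM2r// lip_norm_le.
  by split; apply: le_trans E; apply: le_trans (ler_norm _) (le_trans (lip_normP _ _ hK) _);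
    rewrite ler_wpM2l.
have [f1 f2] := key f fK; have [g1 g2] := key g gK.
move: fga fgb; rewrite !ler_norml => /andP[? ?] /andP[? ?].
by apply/andP; split; nra.
Qed.

(** By Gorelik's principle a small [w] is a difference [U (m + v) - U (m + a')]. Closeness of [f]
    and [g] is imposed at [U (m + a')], with [a'] in a finite set, and holds at [U (m + v)] because
    [m + v] is an almost midpoint of [a] and [b]. *)
Lemma lip_norm_kadec_klee g e : dual_ball g -> 0 < e ->
  exists (s : seq X) (th : R), 0 < th /\ forall f, dual_ball f ->
    (forall x, x \in s -> `|f x - g x| <= th) ->
    forall w, `|f w - g w| <= 2 * C * LV * (lip_norm f - lip_norm g + e) * `|w|.
Proof.
move=> gK e0; have [Y0|nY] := pselect (exists y : Y, y != 0); last first.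
  exists [::], 1; split => // f fK _ w.
  have -> : w = 0.
    rewrite -[w]VK -[0]VK; congr U; apply/eqP; rewrite -subr_eq0.
    by apply: contraPT nY => h; apply; exists (V w - V 0).
  by rewrite (dual_ball0 fK) (dual_ball0 gK) subrr !normr0 mulr0.
have e8 : 0 < e / 8 by lra.
have [a [b [ab gab]]] := lip_norm_adherent gK e8 Y0.
pose M := LU / c; have M0 : 0 < M by rewrite divr_gt0.
have [rho abr rho0] : exists2 rho, p (a - b) = 2 * rho & 0 < rho.
  exists (p (a - b) / 2); first by rewrite mulrC divfK.
  by rewrite divr_gt0// equiv_seminorm_gt0 subr_eq0.
pose h : Y := 2^-1 *: (a - b); pose m : Y := 2^-1 *: (a + b).
have half (z : Y) : 2^-1 *: (z + z) = z.
  by rewrite -mulr2n -[z *+ 2]scaler_nat scalerA mulVf ?scale1r ?pnatr_eq0.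
have am : a = m + h by rewrite /m /h -scalerDr addrACA subrr addr0 half.
have bm : b = m - h by rewrite /m /h -scalerBr opprB [a + b]addrC addrACA subrr addr0 half.
have hr : p h = rho by rewrite /h seminormZ// gtr0_norm ?invr_gt0// abr mulKf.
(* Makes the Lipschitz error [2 * M * eta] equal to [rho * e / 4]. *)
pose eta := rho * e / (8 * M).
have eta0 : 0 < eta by rewrite /eta !(mulr_gt0, invr_gt0)//.
have [n hn] := qnull h eta0.
have r0 : 0 < rho / 2 by lra.
have L0 : 0 <= C * LV * (LU / c) by rewrite !mulr_ge0 ?invr_ge0 ?ltW.
have [A AP] := gorelik n pS qlin qp r0 L0 eta0.
exists [:: U a, U b & [seq U (m + a') | a' <- A]], (rho * e / 8).
split; first by rewrite divr_gt0 ?mulr_gt0 ?mulr_gt0.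
move=> f fK fs.
have small w : `|w| <= rho / (2 * C * LV) -> `|f w - g w| <= rho * (lip_norm f - lip_norm g + e).
  (* Translation by [w] in [X], read in [Y] around [m]; the bound on [w] makes it move points by at
     most [rho / 2]. *)
  move=> wb; pose phi a' := V (w + U (m + a')) - m.
  have phir a' : p (phi a' - a') <= rho / 2.
    rewrite /phi -addrA -opprD -{2}[m + a']UK (le_trans (pC _))//.
    apply: (@le_trans _ _ (C * (LV * (rho / (2 * C * LV))))).
      rewrite ler_wpM2l ?(ltW C0)// (le_trans (Vlip _ _))// addrK.
      by rewrite ler_wpM2l ?(ltW LV0).
    by rewrite le_eqVlt; apply/orP; left; apply/eqP; field; rewrite !gt_eqF.
  have phiL a' b' : p (phi a' - phi b') <= C * LV * (LU / c) * p (a' - b').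
    rewrite /phi opprB addrA subrK (le_trans (pC _))// -!mulrA ler_wpM2l ?(ltW C0)//.
    rewrite (le_trans (Vlip _ _))// ler_wpM2l ?(ltW LV0)// opprD addrACA subrr add0r.
    rewrite (le_trans (Ulip _ _))// ler_wpM2l ?(ltW LU0)// opprD addrACA subrr add0r.
    by rewrite ler_pdivlMl.
  have [a' [a'A a'r a'n]] := AP phi phir phiL.
  set v := phi a' in a'n.
  have vr : p v <= rho.
    have := ler_seminormD pS (v - a') a'; rewrite subrK; have := phir a'; rewrite -/v; lra.
  have Uv : U (m + v) = w + U (m + a') by rewrite /v /phi addrC subrK VK.
  have -> : f w - g w = (f (U (m + v)) - g (U (m + v))) - (f (U (m + a')) - g (U (m + a'))).
    by rewrite Uv (dual_ballD fK) (dual_ballD gK); ring.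
  have ma' : `|f (U (m + a')) - g (U (m + a'))| <= rho * e / 8.
    by apply: fs; rewrite !inE map_f ?orbT.
  have mv : `|f (U (m + v)) - g (U (m + v))| <= rho * (lip_norm f - lip_norm g)
      + 2 * rho * (e / 8) + 2 * (LU / c) * eta + rho * e / 8.
    apply: (@midpoint_dual_le _ _ a b) => //; rewrite ?(ltW eta0)//.
    - have -> : a - (m + v) = h + - v by rewrite {1}am opprD addrACA subrr add0r.
      apply: (@p_coord_split _ _ n) => //; rewrite ?hr ?seminormN ?(ltW eta0)//.
      by move=> k kn; rewrite -scaleN1r (coordZ qlin) mulN1r normrN a'n.
    - have -> : m + v - b = h + v by rewrite bm opprB [m + v]addrC addrACA subrr addr0 addrC.
      by apply: (@p_coord_split _ _ n) => //; rewrite ?hr ?(ltW eta0).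
    - by apply: fs; rewrite !inE eqxx.
    - by apply: fs; rewrite !inE eqxx orbT.
  rewrite (le_trans (ler_normB _ _))// (le_trans (lerD mv ma'))//.
  (* The four error terms add up to [3 / 4 * rho * e]. *)
  have -> : 2 * (LU / c) * eta = rho * e / 4.
    by rewrite /eta -/M; field; rewrite gt_eqF.
  have : 0 < rho * e by rewrite mulr_gt0.
  nra.
move=> w; have [->|w0] := eqVneq w 0.
  by rewrite (dual_ball0 fK) (dual_ball0 gK) subrr !normr0 mulr0.
have nw : 0 < `|w| by rewrite normr_gt0.
have b0 : 0 < rho / (2 * C * LV) by rewrite divr_gt0 ?mulr_gt0 ?mulr_gt0.
pose t := rho / (2 * C * LV) / `|w|.
have t0 : 0 < t by rewrite divr_gt0.
have := small (t *: w).
rewrite normrZ gtr0_norm// /t divfK ?gt_eqF// lexx => /(_ isT).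
rewrite -/t (dual_ballZ fK) (dual_ballZ gK) -mulrBr normrM gtr0_norm// -ler_pdivlMl//.
move=> /le_trans; apply; rewrite le_eqVlt; apply/orP; left; apply/eqP.
by rewrite /t; field; rewrite !gt_eqF.
Qed.

End LipschitzKadecKlee.

(** * Norming functionals and weak* compactness *)

Section HahnBanach.
Variables (R : realType) (X : lmodType R).
Implicit Types (P : X -> R) (x y a : X).

Definition sublinear P :=
  (forall t x, 0 <= t -> P (t *: x) = t * P x) /\ (forall x y, P (x + y) <= P x + P y).

Lemma sublinear0 P : sublinear P -> P 0 = 0.
Proof. by move=> PS; rewrite -(scale0r (0 : X)) PS.1// mul0r. Qed.

Lemma sublinear_opp P x : sublinear P -> - P (- x) <= P x.
Proof. by move=> PS; have := PS.2 x (- x); rewrite subrr sublinear0//; lra. Qed.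

(** The infimum of these values over [t] is again sublinear, lies below [P], and is at most [- P a]
    at [- a]. *)
Definition tilt_values P a x : set R :=
  [set P (x + t *: a) - t * P a | t in [set t | 0 <= t]].

Definition tilt P a x : R := inf (tilt_values P a x).

Section Tilt.
Variables (P : X -> R) (a : X).
Hypothesis PS : sublinear P.

Lemma tilt_values_lbound x : lbound (tilt_values P a x) (- P (- x)).
Proof.
move=> _ [t t0 <-]; have := PS.2 (x + t *: a) (- x).
by rewrite addrAC subrr add0r PS.1//; lra.
Qed.

Lemma tilt_le_at x t : 0 <= t -> tilt P a x <= P (x + t *: a) - t * P a.
Proof.
move=> t0; apply: ge_inf; last by exists t.
by exists (- P (- x)); exact: tilt_values_lbound.
Qed.

Lemma le_tilt x M : (forall t, 0 <= t -> M <= P (x + t *: a) - t * P a) -> M <= tilt P a x.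
Proof.
move=> h; apply: lb_le_inf; first by exists (P (x + 0 *: a) - 0 * P a), 0 => //=.
by move=> _ [t t0 <-]; exact: h.
Qed.

Lemma tilt_le x : tilt P a x <= P x.
Proof. by have := tilt_le_at x (lexx 0); rewrite scale0r addr0 mul0r subr0. Qed.

Lemma tiltN : tilt P a (- a) <= - P a.
Proof.
have := tilt_le_at (- a) ler01; rewrite scale1r addNr mul1r sublinear0//; lra.
Qed.

Lemma sublinear_tilt : sublinear (tilt P a).
Proof.
have le t x : 0 < t -> t * tilt P a x <= tilt P a (t *: x).
  move=> t0; apply: le_tilt => s s0.
  have -> : P (t *: x + s *: a) - s * P a = t * (P (x + (s / t) *: a) - s / t * P a).
    have ts : t * s / t = s by rewrite mulrAC divff ?mul1r ?gt_eqF.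
    by rewrite mulrBr -(PS.1 t _ (ltW t0)) scalerDr scalerA !mulrA ts.
  by rewrite ler_pM2l// tilt_le_at// divr_ge0// ltW.
split=> [t x|x y].
  rewrite le_eqVlt => /predU1P[<-|t0].
    rewrite scale0r mul0r; apply/eqP; rewrite eq_le; apply/andP; split.
      by rewrite (le_trans (tilt_le 0))// sublinear0.
    by apply: le_tilt => s s0; rewrite add0r PS.1// subrr.
  apply/eqP; rewrite eq_le le// andbT -ler_pdivrMl//.
  have := le t^-1 (t *: x); rewrite invr_gt0 => /(_ t0).
  by rewrite scalerA mulVf ?gt_eqF// scale1r.
(* Parameters [t] for [x] and [s] for [y] give the parameter [t + s] for [x + y]. *)
rewrite -lerBlDr; apply: le_tilt => t t0.
rewrite lerBlDl -lerBlDr; apply: le_tilt => s s0.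
rewrite lerBlDr (le_trans (tilt_le_at (x + y) (addr_ge0 t0 s0)))//.
have := PS.2 (x + t *: a) (y + s *: a).
by rewrite addrACA -scalerDl; lra.
Qed.
End Tilt.

(* A minimal sublinear functional equals all its tilts, hence is odd, hence linear. *)
Lemma sublinear_dominates_linear P0 : sublinear P0 ->
  exists P, [/\ forall t x y, P (t *: x + y) = t * P x + P y & forall x, P x <= P0 x].
Proof.
move=> P0S; pose T := {P : X -> R | sublinear P /\ forall x, P x <= P0 x}.
(* The order is reversed: a maximal element for Zorn is a minimal functional. *)
pose rel (s t : T) : bool := `[< forall x, sval t x <= sval s x >].
have Tlb (s : T) x : - P0 (- x) <= sval s x.
  case: s => P [PS PP0] /=; apply: le_trans (sublinear_opp x PS).
  by rewrite lerN2.
have [|||A tot|P Pmin] := @Zorn T rel.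
- by move=> s; apply/asboolP.
- by move=> r s t /asboolP rs /asboolP st; apply/asboolP => x; exact: le_trans (rs x).
- move=> [s ?] [t ?] /asboolP/= st /asboolP/= ts; apply: eq_exist; apply/funext => x.
  by apply/eqP; rewrite eq_le st ts.
- have [[s0 As0]|nA] := pselect (exists s, A s); last first.
    exists (exist _ P0 (conj P0S (fun=> lexx _))) => s As; exfalso; apply: nA; by exists s.
  pose F x := [set sval s x | s in A].
  have F0 x : F x !=set0 by exists (sval s0 x), s0.
  have Flb x : has_lbound (F x) by exists (- P0 (- x)) => _ [s _ <-].
  pose P x := inf (F x).
  have Ps s x : A s -> P x <= sval s x by move=> As; apply: ge_inf => //; exists s.
  have Pge x M : (forall s, A s -> M <= sval s x) -> M <= P x.
    by move=> h; apply: lb_le_inf => // _ [s As <-]; exact: h.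
  have PS : sublinear P.
    have le t x : 0 <= t -> t * P x <= P (t *: x).
      by move=> t0; apply: (Pge) => s As; rewrite (svalP s).1.1// ler_wpM2l// Ps.
    split=> [t x|x y].
      rewrite le_eqVlt => /predU1P[<-|t0].
        rewrite scale0r mul0r; apply/eqP; rewrite eq_le; apply/andP; split.
          by apply: le_trans (Ps s0 0 As0) _; rewrite sublinear0//; case: (svalP s0).
        by apply: (Pge) => s As; rewrite sublinear0//; case: (svalP s).
      apply/eqP; rewrite eq_le le ?(ltW t0)// andbT -ler_pdivrMl//.
      have := le t^-1 (t *: x); rewrite invr_ge0 => /(_ (ltW t0)).
      by rewrite scalerA mulVf ?gt_eqF// scale1r.
    rewrite -lerBlDr; apply: (Pge) => s As.
    rewrite lerBlDl -lerBlDr; apply: (Pge) => t At; rewrite lerBlDr.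
    (* In a chain, the smaller of [s] and [t] serves for both arguments. *)
    have [/asboolP st|/asboolP ts] := tot s t As At.
      apply: le_trans (Ps t _ At) _; apply: le_trans ((svalP t).1.2 _ _) _.
      by rewrite addrC lerD2l.
    apply: le_trans (Ps s _ As) _; apply: le_trans ((svalP s).1.2 _ _) _.
    by rewrite addrC lerD2r.
  have PP0 x : P x <= P0 x by apply: le_trans (Ps s0 x As0) _; exact: (svalP s0).2.
  exists (exist _ P (conj PS PP0)) => s As; apply/asboolP => x /=; exact: Ps.
exists (sval P); have [PS PP0] := svalP P; split => //.
have odd a : sval P (- a) = - sval P a.
  have tiltP0 x : tilt (sval P) a x <= P0 x := le_trans (tilt_le a PS x) (PP0 x).
  have /(congr1 sval)/= E : exist _ (tilt (sval P) a) (conj (sublinear_tilt a PS) tiltP0) = P.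
    by apply: Pmin; apply/asboolP => x /=; exact: tilt_le.
  apply/eqP; rewrite eq_le; apply/andP; split; first by rewrite -{1}E tiltN.
  by have := sublinear_opp a PS; lra.
have add x y : sval P (x + y) = sval P x + sval P y.
  apply/eqP; rewrite eq_le PS.2/=; have := PS.2 (x + y) (- y).
  by rewrite addrK odd; lra.
move=> t x y; rewrite add; congr (_ + _); have [t0|t0] := leP 0 t; first exact: PS.1.
by rewrite -[t in LHS]opprK scaleNr odd PS.1 ?mulNr ?opprK// oppr_ge0 ltW.
Qed.

End HahnBanach.

(** Hahn-Banach is applied to the norm tilted at [x0]: a linear functional below it is at most minus
    the norm of [x0] at [- x0]. *)
Lemma dual_ball_norming (R : realType) (X : normedModType R) (x0 : X) :
  exists f, dual_ball f /\ f x0 = `|x0|.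
Proof.
have nS : sublinear (fun x : X => `|x|).
  by split=> [t x t0|]; [rewrite normrZ ger0_norm|exact: ler_normD].
have [f [flin fle]] := sublinear_dominates_linear (sublinear_tilt x0 nS).
have f0 : f 0 = 0 by have := flin 1 0 0; rewrite scaler0 addr0 mul1r; lra.
have fN x : f (- x) = - f x by rewrite -scaleN1r -[_ *: x]addr0 flin f0 addr0 mulN1r.
have fx x : f x <= `|x| := le_trans (fle x) (tilt_le x0 nS x).
exists f; split; first split => // x.
  by rewrite ler_norml fx andbT; have := fx (- x); rewrite fN normrN; lra.
apply/eqP; rewrite eq_le fx/=.
by have := le_trans (fle (- x0)) (tiltN x0 nS); rewrite fN lerN2.
Qed.

Lemma closed_affine_relation (R : realType) (T : topologicalType) (F G H : T -> R) (a : R) :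
  continuous F -> continuous G -> continuous H -> closed [set t | F t = a * G t + H t].
Proof.
move=> cF cG cH; rewrite (_ : [set t | _] = (F - ((fun t => a * G t) + H)) @^-1` [set y | y = 0]).
  apply: preimage_closed => // t _.
  by apply: cvgB; [exact: cF|apply: cvgD; [apply: cvgMr; exact: cG|exact: cH]].
apply/seteqP; split=> t /=; rewrite !fctE; first by move=> ->; rewrite subrr.
by move/eqP; rewrite subr_eq0 => /eqP.
Qed.

Lemma nbhs_continuous_dist (R : realType) (T : topologicalType) (F : T -> R) (g : T) (e : R) :
  continuous F -> 0 < e -> nbhs g [set f | `|F f - F g| <= e].
Proof.
move=> cF e0.
have : nbhs g (F @^-1` ball (F g) e) by apply: cF; exact: nbhsx_ballx.
by apply: filterS => f /=; rewrite /ball/= distrC => /ltW.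
Qed.

Definition pointwise_functions (R : realType) (X : normedModType R) :=
  prod_topology (fun _ : X => R^o : topologicalType).

HB.instance Definition _ (R : realType) (X : normedModType R) :=
  Topological.on (pointwise_functions X).
HB.instance Definition _ (R : realType) (X : normedModType R) :=
  isPointed.Build (pointwise_functions X) (fun=> 0).

Section DualBallCompact.
Variables (R : realType) (X : normedModType R).
Local Notation W := (pointwise_functions X).

Let eval_continuous (x : X) : continuous (fun f : W => f x : R).
Proof. exact: proj_continuous. Qed.

(** Banach-Alaoglu: linearity is a closed condition inside a product of segments, compact by
    Tychonoff. *)
Lemma dual_ball_compact : compact (@dual_ball R X : set W).
Proof.
have box : compact ([set f | forall x : X, [set` `[- `|x|, `|x|]%R] (f x)] : set W).
  apply: (@tychonoff X (fun=> R^o) (fun x => [set` `[- `|x|, `|x|]%R])) => x.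
  exact: segment_compact.
rewrite (_ : @dual_ball R X = (\bigcap_(axy in [set: R * X * X])
    [set f : W | (f (axy.1.1 *: axy.1.2 + axy.2) : R) = axy.1.1 * f axy.1.2 + f axy.2])
   `&` [set f : W | forall x : X, [set` `[- `|x|, `|x|]%R] (f x)]).
  rewrite setIC; apply: compact_closedI => //; apply: closed_bigI => -[[a x] y] _.
  by apply: closed_affine_relation; exact: eval_continuous.
apply/seteqP; split=> f.
  by move=> [flin fx]; split=> [[[a x] y] _|x] /=; rewrite ?in_itv/= -?ler_norml.
move=> [flin fx]; split=> [a x y|x]; first exact: (flin (a, x, y)).
by have := fx x; rewrite /= in_itv/= -ler_norml.
Qed.

(** Compactness stated without topology: [s] and [th] describe a basic weak* neighbourhood of [g],
    and finitely many of their interiors cover the ball. *)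
Lemma dual_ball_cover (V : (X -> R) -> set (X -> R)) :
  (forall g, dual_ball g -> exists (s : seq X) (th : R), 0 < th /\
     forall f, dual_ball f -> (forall x, x \in s -> `|f x - g x| <= th) -> V g f) ->
  exists n (G : 'I_n -> X -> R), (forall i, dual_ball (G i)) /\
    forall f, dual_ball f -> exists i, V (G i) f.
Proof.
move=> nb.
have /choice[F FP] : forall g, exists sth : seq X * R, 0 < sth.2 /\
    (dual_ball g -> forall f, dual_ball f ->
     (forall x, x \in sth.1 -> `|f x - g x| <= sth.2) -> V g f).
  move=> g; have [gK|ngK] := pselect (dual_ball g); last by exists ([::], 1).
  by have [s [th [th0 h]]] := nb g gK; exists (s, th).
pose O (g : W) : set W := [set f : W | forall x, x \in (F g).1 -> `|(f x : R) - g x| <= (F g).2].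
have Onb (g : W) : nbhs g (O g).
  rewrite /O; elim: (F g).1 => [|x s IH]; first by apply: filterS filterT.
  have xnb : nbhs g [set f : W | `|(f x : R) - g x| <= (F g).2].
    by apply: (nbhs_continuous_dist (F := fun f : W => f x : R)) => //; have [] := FP g.
  apply: filterS (filterI xnb IH) => f [h1 h2] y; rewrite inE => /predU1P[->//|]; exact: h2.
have cov : cover_compact (@dual_ball R X : set W).
  by rewrite -compact_cover; exact: dual_ball_compact.
have [||G GK {}cov] := cov W (@dual_ball R X) (fun g => (O g)^°).
- by move=> g gK; exact: open_interior.
- by move=> g gK; exists g => //; exact: Onb.
pose s : seq W := finmap.enum_fset G.
have sK (i : 'I_(size s)) : dual_ball (nth (fun=> 0) s i).
  by have := GK (nth (fun=> 0) s i) (mem_nth _ (ltn_ord i)); rewrite inE.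
exists (size s), (fun i => nth (fun=> 0) s i); split=> // f fK.
have [g gG Ogf] := cov f fK.
have gs : (index g s < size s)%N by rewrite index_mem.
exists (Ordinal gs) => /=; rewrite nth_index//.
have gK : dual_ball g by have := GK g gG; rewrite inE.
by apply: (FP g).2 => //; exact: interior_subset Ogf.
Qed.
End DualBallCompact.

(** * Embedding into c0 *)

Lemma supnorm_le (R : realType) (u : nat -> R) M : (forall k, `|u k| <= M) -> supnorm u <= M.
Proof. by move=> uM; apply: ge_sup => [|_ [k _ <-]//]; exists `|u 0%N|, 0%N. Qed.

Lemma le_supnorm (R : realType) (u : nat -> R) M k : (forall k, `|u k| <= M) -> `|u k| <= supnorm u.
Proof.
move=> uM; apply: (@ub_le_sup _ (range (fun n => `|u n|))); last by exists k.
by exists M => _ [j _ <-].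
Qed.

Lemma c0P (R : realType) (u : nat -> R) : c0 u <->
  forall e : R, 0 < e -> exists n, forall k, (n <= k)%N -> `|u k| <= e.
Proof.
split=> [/cvgrPdist_le u0 e e0|u0].
  have [n _ h] := u0 e e0; exists n => k nk.
  by have := h k nk; rewrite sub0r normrN.
apply/cvgrPdist_le => e e0; have [n h] := u0 e e0; exists n => // k nk /=.
by rewrite sub0r normrN; exact: h.
Qed.

Section Embedding.
Variables (R : realType) (X : normedModType R) (N : (X -> R) -> R) (M D : R) (z : nat -> X).
Hypothesis N0 : forall f, dual_ball f -> 0 <= N f.
Hypothesis NM : forall f, dual_ball f -> N f <= M.
Hypothesis D0 : 0 < D.
Hypothesis zdense : forall x (e : R), 0 < e -> exists l, `|x - z l| <= e.
Hypothesis X0 : exists w : X, w != 0.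
Hypothesis NKK : forall g e, dual_ball g -> 0 < e ->
  exists (s : seq X) (th : R), 0 < th /\ forall f, dual_ball f ->
    (forall x, x \in s -> `|f x - g x| <= th) ->
    forall w, `|f w - g w| <= D * (N f - N g + e) * `|w|.

Lemma dual_ball_zero : dual_ball (fun _ : X => 0 : R).
Proof. by split=> [a x y|x]; rewrite ?mulr0 ?addr0 ?normr0. Qed.

Let M0 : 0 <= M. Proof. exact: le_trans (N0 dual_ball_zero) (NM dual_ball_zero). Qed.

(** At level 0 the zero functional must be a node near the whole ball: [M] absorbs its [N], and
    [D^-1] cancels the factor [D]. *)
Let eps0 := M + D^-1.
Let eps n : R := eps0 / 2 ^+ n.

Let eps0_gt0 : 0 < eps0. Proof. by rewrite ltr_wpDl// invr_gt0. Qed.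

Let eps_gt0 n : 0 < eps n. Proof. by rewrite divr_gt0// exprn_gt0. Qed.

Let eps_le n m : (n <= m)%N -> eps m <= eps n.
Proof.
move=> nm; rewrite ler_pM2l// lef_pV2 ?posrE ?exprn_gt0//.
by rewrite ler_eXn2l// ltr1n.
Qed.

Let sum_eps n : \sum_(k < n) eps k <= 2 * eps0 - 2 * eps n.
Proof.
elim: n => [|n IH]; first by rewrite big_ord0 /eps expr0 divr1; have := eps0_gt0; lra.
rewrite big_ord_recr/=; have -> : eps n.+1 = eps n / 2.
  by rewrite /eps exprS invfM mulrCA mulrC.
lra.
Qed.

Let eps_small e : 0 < e -> exists n, eps n <= e.
Proof.
move=> e0; exists (Num.trunc (eps0 / e)).+1.
rewrite ler_pdivrMr ?exprn_gt0// -ler_pdivrMl//.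
have h : eps0 / e < (Num.trunc (eps0 / e)).+1%:R by exact: truncnS_gt.
rewrite [leLHS]mulrC (le_trans (ltW h))// -natrX ler_nat ltnW// ltn_expl//.
Qed.

(** The square anticipates a division by some [b >= D * eps n], after which [eps n] remains. *)
Definition near_node n (g f : X -> R) :=
  (forall w, `|f w - g w| <= D * (N f - N g + eps n) * `|w|) /\
  (forall l, (l < n)%N -> `|f (z l) - g (z l)| <= D * eps n ^+ 2).

Record level := Level {
  level_size : nat;
  level_node : 'I_level_size -> X -> R;
  level_seq : seq (X -> R) }.

Local Notation fnth := (nth (fun _ : X => 0 : R)).

(* [level_seq] collects the functionals [(g' - g) / b] along the edges of the tree,
   [b] being the gain of [N]: the gains telescope, so every node is a combination of
   them with bounded coefficient sum. *)
Definition level_ok n (S : level) :=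
  [/\ forall i, dual_ball (level_node (l := S) i),
      forall f, dual_ball f -> exists i, near_node n (level_node (l := S) i) f,
      forall i x sg, 0 <= sg ->
        (forall j, (j < size (level_seq S))%N -> `|fnth (level_seq S) j x| <= sg) ->
        `|level_node (l := S) i x| <=
          sg * (D * (N (level_node (l := S) i) + 2 * \sum_(k < n) eps k)) &
      forall j, dual_ball (fnth (level_seq S) j)].

(** Nonempty blocks make the union of the levels an infinite sequence; smallness on the first [n]
    points [z l] makes it weak*-null. *)
Definition level_ext n (S S' : level) :=
  exists2 s, level_seq S' = level_seq S ++ s & (0 < size s)%N /\
    forall j l, (j < size s)%N -> (l < n)%N -> `|fnth s j (z l)| <= eps n.

Lemma level_ok0 : level_ok 0 (@Level 1 (fun=> fun=> 0) [::]).
Proof.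
split=> //=; last 1 first.
- by move=> j; rewrite nth_nil; exact: dual_ball_zero.
- by move=> i; exact: dual_ball_zero.
- move=> f fK; exists ord0; split=> // w; rewrite subr0 (le_trans (dual_ball_le fK w))//.
  apply: ler_peMl => //; rewrite -ler_pdivrMl// mulr1 /eps expr0 divr1 /eps0.
  by have := N0 fK; have := NM dual_ball_zero; lra.
- move=> i x sg sg0 _; rewrite normr0 big_ord0 mulr0 addr0.
  by rewrite !mulr_ge0// ?(ltW D0)// N0//; exact: dual_ball_zero.
Qed.

Lemma near_node_cover n : exists k (G : 'I_k -> X -> R), (forall i, dual_ball (G i)) /\
    forall f, dual_ball f -> exists i, near_node n (G i) f.
Proof.
apply: (@dual_ball_cover R X (near_node n)) => g gK.
have [s [th [th0 h]]] := NKK gK (eps_gt0 n).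
exists (s ++ [seq z l | l <- iota 0 n]), (Num.min th (D * eps n ^+ 2)); split.
  by rewrite lt_min th0 mulr_gt0// exprn_gt0.
move=> f fK fg; split.
  apply: h => // x xs; apply: le_trans (fg x _) _; first by rewrite mem_cat xs.
  by rewrite ge_min lexx.
move=> l ln; apply: le_trans (fg (z l) _) _; last by rewrite ge_min lexx orbT.
by rewrite mem_cat map_f ?orbT// mem_iota.
Qed.

Lemma level_step n S : level_ok n S -> exists S', level_ok n.+1 S' /\ level_ext n S S'.
Proof.
move=> [SK Scov Sbd Sseq]; have [k [G [GK Gcov]]] := near_node_cover n.+1.
have /choice[par parP] : forall i, exists j, near_node n (level_node (l := S) j) (G i).
  by move=> i; exact: Scov.
pose g i := level_node (l := S) (par i).
(* Nearness to the parent needs only [eps n] here; the second [eps n] keeps [b i] at least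
   [D * eps n] even when [N] does not grow. *)
pose b i := D * (N (G i) - N (g i) + 2 * eps n).
(* A negative value would bound a norm by a negative number at a nonzero [w]. *)
have gain i : 0 <= N (G i) - N (g i) + eps n.
  have [w w0] := X0; have [/(_ w) h _] := parP i.
  have := le_trans (normr_ge0 _) h.
  by rewrite pmulr_lge0 ?normr_gt0// pmulr_rge0.
have bD i : D * eps n <= b i by rewrite ler_pM2l//; have := gain i; lra.
have b0 i : 0 < b i by apply: lt_le_trans (bD i); rewrite mulr_gt0.
pose phi i : X -> R := fun x => (G i x - g i x) / b i.
have phiK i : dual_ball (phi i).
  split=> [a x y|x].
    by rewrite /phi /g (GK i).1 (SK (par i)).1; ring.
  rewrite normrM normfV (gtr0_norm (b0 i)) ler_pdivrMr// mulrC.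
  apply: le_trans ((parP i).1 x) _; rewrite ler_wpM2r// ler_pM2l//.
  by have := eps_gt0 n; lra.
have k0 : (0 < k)%N by have [i _] := Gcov _ dual_ball_zero; case: (k) i => [[]|].
pose s := [seq phi i | i <- enum 'I_k].
have sz : size s = k by rewrite size_map size_enum_ord.
have snth (i : 'I_k) : fnth s i = phi i.
  by rewrite (nth_map i) ?size_enum_ord// nth_ord_enum.
exists (@Level k G (level_seq S ++ s)); split; last first.
  exists s => //; rewrite sz; split=> // j l jk ln.
  rewrite (snth (Ordinal jk)) normrM normfV (gtr0_norm (b0 _)) ler_pdivrMr//.
  apply: le_trans ((parP _).2 l ln) _; rewrite expr2 mulrA mulrC ler_pM2l//.
split=> //= [i x sg sg0 hsg|j]; last first.
  rewrite nth_cat; case: ltnP => _; first exact: Sseq.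
  case: (ltnP (j - size (level_seq S)) k) => [h|h].
    by rewrite (snth (Ordinal h)).
  by rewrite nth_default ?sz//; exact: dual_ball_zero.
have gx : `|g i x| <= sg * (D * (N (g i) + 2 * \sum_(k < n) eps k)).
  apply: Sbd => // j js; have := hsg j; rewrite size_cat nth_cat js; apply.
  by rewrite ltn_addr.
have phix : `|phi i x| <= sg.
  have ge : (size (level_seq S) + i < size (level_seq S))%N = false by rewrite ltnNge leq_addr.
  have := hsg (size (level_seq S) + i)%N; rewrite nth_cat ge addKn snth; apply.
  by rewrite size_cat ltn_add2l sz.
(* The coefficient [b i] adds exactly the gain of [N] and [2 * eps n] to the parent's bound, so the
   bounds telescope. *)
have -> : G i x = g i x + b i * phi i x.
  by rewrite /phi mulrC divfK ?gt_eqF// addrC subrK.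
apply: le_trans (ler_normD _ _) _; rewrite normrM (gtr0_norm (b0 i)).
apply: le_trans (lerD gx (ler_wpM2l (ltW (b0 i)) phix)) _.
rewrite big_ord_recr/= /b le_eqVlt; apply/orP; left; apply/eqP.
ring.
Qed.

Lemma level_sequence : exists L : nat -> level,
  forall n, level_ok n (L n) /\ level_ext n (L n) (L n.+1).
Proof.
have /choice[F FP] : forall nS : nat * level, exists S', level_ok nS.1 nS.2 ->
    level_ok nS.1.+1 S' /\ level_ext nS.1 nS.2 S'.
  move=> [n S] /=; have [ok|nok] := pselect (level_ok n S); last by exists S.
  by have [S' h] := level_step ok; exists S'.
pose L := fix L n := if n is n'.+1 then F (n', L n') else @Level 1 (fun=> fun=> 0) [::].
have Lok n : level_ok n (L n).
  by elim: n => [|n IH]; [exact: level_ok0|exact: (FP (n, L n) IH).1].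
by exists L => n; split=> //; exact: (FP (n, L n) (Lok n)).2.
Qed.

(** The embedding evaluates the edge functionals. For the lower bound, a functional norming [x] is
    compared at some [z l] near [x] with a node, which the coefficient bound controls. *)
Lemma kadec_klee_embeds_c0 : lin_iso_subspace_c0 X.
Proof.
have [L LP] := level_sequence; pose s n := level_seq (L n).
have sext n : exists2 t, s n.+1 = s n ++ t & (0 < size t)%N /\
    forall j l, (j < size t)%N -> (l < n)%N -> `|fnth t j (z l)| <= eps n by exact: (LP n).2.
have ssz n : (n <= size (s n))%N.
  elim: n => [//|n IH]; have [t -> [t0 _]] := sext n; rewrite size_cat -addn1.
  exact: leq_add.
have pref n d j : (j < size (s n))%N ->
    (j < size (s (n + d)%N))%N /\ fnth (s (n + d)%N) j = fnth (s n) j.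
  move=> jn; elim: d => [|d [IH1 IH2]]; first by rewrite addn0; split.
  have [t st _] := sext (n + d)%N; rewrite addnS st size_cat nth_cat IH1 IH2; split=> //.
  by rewrite ltn_addr.
(* Level [j + 1] has more than [j] entries and later levels only append, so this is entry [j] of
   every long enough level. *)
pose phi j := fnth (s j.+1) j.
have phiE n j : (j < size (s n))%N -> phi j = fnth (s n) j.
  move=> jn; have [nj|jn'] := leqP n j.+1.
    by have [_] := pref n (j.+1 - n)%N j jn; rewrite subnKC.
  have [_] := pref j.+1 (n - j.+1)%N j (ssz j.+1); rewrite subnKC// ltnW//.
have phiK j : dual_ball (phi j) by have [[_ _ _ h] _] := LP j.+1; exact: h.
(* An entry missing at level [n] was appended at a stage [n + d], where smallness at [z l] was
   required. *)
have phiz n d j l : (l < n)%N -> (size (s n) <= j)%N -> (j < size (s (n + d)%N))%N ->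
    `|phi j (z l)| <= eps n.
  move=> ln nj; elim: d => [|d IH]; first by rewrite addn0 ltnNge nj.
  have [h _|h] := ltnP j (size (s (n + d)%N)); first exact: IH.
  have [t st [t0 tz]] := sext (n + d)%N; rewrite addnS => hj.
  rewrite (phiE _ _ hj) st nth_cat ltnNge h/=.
  apply: le_trans (eps_le (leq_addr d n)); apply: tz; last exact: ltn_addr.
  by move: hj; rewrite st size_cat ltn_subLR.
pose T x j := phi j x.
have Tle x k : `|T x k| <= `|x| by exact: dual_ball_le.
exists T; split; first by move=> a x y k; exact: (phiK k).1.
split.
  move=> x; apply/c0P => e e0; have e2 : 0 < e / 2 by lra.
  have [l xl] := zdense x e2; have [n0 n0e] := eps_small e2.
  pose n := maxn n0 l.+1; exists (size (s n)) => j nj.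
  have -> : T x j = phi j (x - z l) + phi j (z l) by rewrite dual_ballB// subrK.
  have h1 := le_trans (dual_ball_le (phiK j) (x - z l)) xl.
  have h2 : `|phi j (z l)| <= eps n.
    have nj1 : (n <= j.+1)%N by apply: leq_trans (ssz n) (leqW nj).
    apply: (@phiz n (j.+1 - n)%N) => //; first by rewrite leq_maxr.
    by rewrite subnKC// ssz.
  have h3 : eps n <= eps n0 by apply: eps_le; rewrite leq_maxl.
  by rewrite (le_trans (ler_normD _ _))//; lra.
(* The coefficient bound, with [N] at most [M] and the sum of the [eps k] at most [2 * eps0]. *)
pose C := D * (M + 4 * eps0).
have C0 : 0 < C by rewrite mulr_gt0//; have := eps0_gt0; have := M0; lra.
exists C^-1, 1; rewrite invr_gt0; split=> //; split=> // x; split; last first.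
  by rewrite mul1r; exact: supnorm_le.
rewrite ler_pdivrMl//; apply/ler_addgt0Pr => e e0.
have [f [fK fx]] := dual_ball_norming x.
have e4 : 0 < e / 4 by lra.
have [l xl] := zdense x e4.
(* The bound 1 gives [eps n ^+ 2 <= eps n]. Passing from [f x] to [f (z l)], to [G (z l)] and to
   [G x] then costs [e / 4], [e / 2] and [e / 4]. *)
have De : 0 < Num.min 1 (e / 2 / D) by rewrite lt_min ltr01 divr_gt0//; lra.
have [n0 n0e] := eps_small De; pose n := maxn n0 l.+1.
have epsn : D * eps n ^+ 2 <= e / 2.
  have h3 : eps n <= Num.min 1 (e / 2 / D) by apply: le_trans n0e; apply: eps_le; rewrite leq_maxl.
  rewrite mulrC -ler_pdivlMr// expr2.
  move: h3; rewrite le_min => /andP[h3 h4]; apply: le_trans h4.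
  by rewrite ler_piMl// ltW.
have [[GK cov bd _] _] := LP n.
have [i [_ near]] := cov f fK.
have Gx := bd i x (supnorm (T x)); rewrite -/(s n) in Gx.
set G := level_node i in near Gx.
have {}Gx : `|G x| <= supnorm (T x) * C.
  apply: le_trans (Gx _ _) _.
  - exact: le_trans (normr_ge0 (T x 0)) (le_supnorm _ (Tle x)).
  - by move=> j jn; rewrite -phiE//; exact: le_supnorm (Tle x).
  apply: ler_wpM2l; first exact: le_trans (normr_ge0 (T x 0)) (le_supnorm _ (Tle x)).
  rewrite ler_pM2l//; have := NM (GK i); have := sum_eps n; have := eps_gt0 n; rewrite -/G; lra.
have nz := near l (leq_maxr _ _).
have h1 := le_trans (dual_ball_le fK (x - z l)) xl.
have h2 := le_trans (dual_ball_le (GK i) (x - z l)) xl.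
move: nz h1 h2 Gx; rewrite (dual_ballB fK) (dual_ballB (GK i)) -/G fx.
rewrite !ler_norml => /andP[? ?] /andP[? ?] /andP[? ?] /andP[? ?].
by rewrite [C * _]mulrC; lra.
Qed.

End Embedding.

(** * Separability and conclusion *)

Lemma floor_eq_dist (R : realType) (x y : R) : Num.floor x = Num.floor y -> `|x - y| <= 1.
Proof.
move=> xy; have /andP[x1 x2] := floor_itv x; have /andP[y1 y2] := floor_itv y.
move: x1 x2 y1 y2; rewrite xy intrD rmorph1 => x1 x2 y1 y2.
by rewrite ler_norml; apply/andP; split; lra.
Qed.

(* A vector is coded by the integer parts of finitely many rescaled coordinates,
   together with a bound on the remaining ones. *)
Lemma null_coordinates_separable (R : realType) (E : zmodType) (q : nat -> E -> R) :
  (forall y (e : R), 0 < e -> exists n, forall k, (n <= k)%N -> `|q k y| <= e) ->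
  exists d : nat -> E, forall y (e : R), 0 < e ->
    exists i, forall k, `|q k y - q k (d i)| <= e.
Proof.
move=> qnull.
pose coded (c : nat * nat * seq int) y :=
  (forall k, (k < c.1.1)%N -> Num.floor (q k y * c.1.2.+1%:R) = nth 0 c.2 k) /\
  (forall k, (c.1.1 <= k)%N -> `|q k y| <= c.1.2.+1%:R^-1).
have /choice[g gP] : forall c, exists y, (exists y', coded c y') -> coded c y.
  move=> c; have [[y cy]|nc] := pselect (exists y', coded c y'); first by exists y.
  by exists 0.
exists (fun i => if unpickle i is Some c then g c else 0) => y e e0.
pose m := Num.trunc (2 / e).
have m0 : 0 < m.+1%:R :> R by rewrite ltr0n.
have me : 2 * m.+1%:R^-1 <= e.
  rewrite ler_pdivrMr// -ler_pdivrMl// [leLHS]mulrC.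
  by apply: ltW; exact: truncnS_gt.
have mi0 : 0 < m.+1%:R^-1 :> R by rewrite invr_gt0.
have [n yn] := qnull y _ mi0.
pose c : nat * nat * seq int := (n, m, [seq Num.floor (q k y * m.+1%:R) | k <- iota 0 n]).
have cy : coded c y.
  by split=> [k kn|k nk] /=; [rewrite (nth_map 0%N) ?size_iota// nth_iota|exact: yn].
have [gc1 gc2] := gP c (ex_intro _ y cy).
exists (pickle c) => k; rewrite pickleK; have [nk|kn] := leqP n k.
  apply: le_trans (ler_normB _ _) _; apply: le_trans me.
  by rewrite mulr_natl mulr2n lerD// ?yn ?gc2.
have /floor_eq_dist : Num.floor (q k y * m.+1%:R) = Num.floor (q k (g c) * m.+1%:R).
  by rewrite gc1// cy.1.
rewrite -mulrBl normrM (gtr0_norm m0) -ler_pdivlMr// div1r => h.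
by apply: le_trans h (le_trans _ me); rewrite mulr_natl mulr2n lerDl ltW.
Qed.

Lemma lipschitz_map_pos (R : realType) (A B : normedModType R) (f : A -> B) :
  lipschitz_map f -> exists2 L : R, 0 < L & forall x y, `|f x - f y| <= L * `|x - y|.
Proof.
move=> [L fL]; exists (`|L| + 1) => [|x y]; first by rewrite ltr_wpDl.
apply: le_trans (fL x y) _; rewrite ler_wpM2r//.
by have := ler_norm L; lra.
Qed.

Theorem theorem2p1 (R : realType) (X Y : completeNormedModType R) :
  lipschitz_isomorphic X Y ->
  lin_iso_subspace_c0 Y ->
  lin_iso_subspace_c0 X.
Proof.
move=> [U [V [UK [VK [/lipschitz_map_pos[LU LU0 Ulip] /lipschitz_map_pos[LV LV0 Vlip]]]]]].
move=> [T [Tlin [Tc0 [c [C [c0 [C0 cC]]]]]]].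
(* If [X] is zero, the zero map is an embedding; otherwise a nonzero vector is available for
   [kadec_klee_embeds_c0]. *)
have [X0|nX0] := pselect (exists w : X, w != 0); last first.
  have X0 (x : X) : x = 0.
    by apply/eqP; apply: contrapT => /negP x0; apply: nX0; exists x.
  exists (fun=> fun=> 0); split; first by move=> a y z n; rewrite mulr0 addr0.
  split; first by move=> y; exact: cvg_cst.
  exists 1, 1; split=> //; split=> // x; rewrite (X0 x) normr0 mulr0.
  suff -> : supnorm (fun=> 0 : R) = 0 by [].
  apply/eqP; rewrite eq_le supnorm_le/=; last by move=> k; rewrite normr0.
  by rewrite -[leLHS](normr0 R) (@le_supnorm _ (fun=> 0) 0 0%N)// => k; rewrite normr0.
pose q k y := T y k; pose p y := supnorm (T y).
have qlin k a y z : q k (a *: y + z) = a * q k y + q k z by exact: Tlin.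
have qnull y (e : R) : 0 < e -> exists n, forall k, (n <= k)%N -> `|q k y| <= e.
  by move: e; exact/c0P/Tc0.
have qbound y : exists B, forall k, `|q k y| <= B.
  have [n yn] := qnull y 1 ltr01.
  exists (1 + \sum_(j < n) `|q j y|) => k; have [nk|kn] := leqP n k.
    by apply: le_trans (yn k nk) _; rewrite lerDl sumr_ge0.
  by rewrite (bigD1 (Ordinal kn))//= addrCA lerDl addr_ge0// sumr_ge0.
have qp k y : `|q k y| <= p y by have [B yB] := qbound y; exact: le_supnorm yB.
have pq y M : (forall k, `|q k y| <= M) -> p y <= M by exact: supnorm_le.
have p0 y : 0 <= p y by apply: le_trans (qp 0%N y).
have pS : seminorm p.
  have le a y : p (a *: y) <= `|a| * p y.
    by apply: (pq) => k; rewrite (coordZ qlin) normrM ler_wpM2l.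
  split=> [a y|y z].
    apply/eqP; rewrite eq_le le/=; have [->|a0] := eqVneq a 0; first by rewrite normr0 mul0r.
    rewrite -ler_pdivlMl ?normr_gt0//; have := le a^-1 (a *: y).
    by rewrite scalerA mulVf// scale1r normfV.
  by apply: (pq) => k; rewrite (coordD qlin) (le_trans (ler_normD _ _))// lerD.
have cp y : c * `|y| <= p y by have [] := cC y.
have pC y : p y <= C * `|y| by have [] := cC y.
have [d dP] := null_coordinates_separable qnull.
apply: (@kadec_klee_embeds_c0 R X (lip_norm U p) (LU / c) (2 * C * LV) (U \o d)) => //.
- by move=> f fK; apply: (lip_norm_ge0 c0 LU0 Ulip pS cp fK).
- by move=> f fK; apply: (lip_norm_le c0 LU0 Ulip pS cp fK).
- by rewrite !mulr_gt0.
(* Density of [U \o d]: the map [U] is Lipschitz with constant [LU / c] for [p], whence the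
   tolerance [e * c / LU] in [Y]. *)
- move=> x e e0; have e1 : 0 < e * c / LU by rewrite divr_gt0// mulr_gt0.
  have [i di] := dP (V x) _ e1; exists i => /=.
  rewrite -{1}[x]VK (le_trans (Ulip _ _))// -ler_pdivlMl// mulrC.
  rewrite -(ler_pM2l c0) (le_trans (cp _))//.
  have -> : c * (e / LU) = e * c / LU by rewrite mulrCA mulrA.
  by apply: (pq) => k; rewrite (coordB qlin).
- move=> g e gK e0.
  by apply: (lip_norm_kadec_klee UK VK c0 C0 LU0 LV0 Ulip Vlip pS qlin qp pq qnull cp pC).
Qed.
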